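(* Let $\Omega$ be a system of $\ell$ equations in the variables $u_1,\dots,u_m,v$: $$\sum_{j=1}^m c_{i,j}\,u_j=b_i\,v,\qquad i=1,\dots,\ell,$$ where the $c_{i,j}$ and $b_i$ are non-negative integers such that for each $i\in[1,\ell]$ at least two of $c_{i,1},\dots,c_{i,m}$ are nonzero and $\sum_{j=1}^m c_{i,j}=b_i>0$. Let $D=\max_{1\le i\le\ell}b_i$, $\gamma_1=D^2\sqrt{\tfrac12\log D}$ and $\gamma_2=2\sqrt{2\log D}$. Then for integers $q>D^2$, $$s(q;\Omega)\ \ge\ \gamma_1\,q\,e^{-\gamma_2\sqrt{\log q}-\frac12\log\log q}\,(1+o(1)),$$ where $o(1)$ denotes a correction factor (depending on $q$) that tends to $0$ as $q\to\infty$.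
   Context: For integers $a\le b$, $[a,b]=\{x\in\mathbb{Z}: a\le x\le b\}$; $\log$ is the natural logarithm. A set $S\subseteq[0,q-1]$ contains a proper solution over $\mathbb{Z}_q$ to the equation $\sum_{j=1}^m c_{i,j}u_j=b_iv$ if there exist pairwise distinct $u_1,\dots,u_m,v\in S$ with $\sum_{j=1}^m c_{i,j}u_j\equiv b_iv\pmod q$. $s(q;\Omega)$ denotes the size of the largest subset of $[0,q-1]$ containing no proper solution over $\mathbb{Z}_q$ to any equation of $\Omega$. *)

(* Defs.v *)
From mathcomp Require Import all_boot all_order all_algebra.
From mathcomp Require Import all_classical all_reals all_analysis.

Set Implicit Arguments.
Unset Strict Implicit.
Unset Printing Implicit Defensive.

(* The ground set [0, q-1] is 'I_q, and a system of l equations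
     \sum_(j < m) c i j * u_j = b i * v     (i < l)
   is given by its coefficients c and b. *)

Local Open Scope nat_scope.

Definition has_proper_solution (q m : nat) (c : 'I_m -> nat) (b : nat)
    (S : {set 'I_q}) : bool :=
  [exists u : {ffun 'I_m -> 'I_q}, exists v : 'I_q,
    [&& [forall j, u j \in S], v \in S,
        injectiveb u, [forall j, u j != v]
      & \sum_(j < m) c j * u j == b * v %[mod q]]].

Definition solution_free (q l m : nat) (c : 'I_l -> 'I_m -> nat)
    (b : 'I_l -> nat) (S : {set 'I_q}) : bool :=
  [forall i, ~~ has_proper_solution (c i) (b i) S].

Definition max_solution_free (q l m : nat) (c : 'I_l -> 'I_m -> nat)
    (b : 'I_l -> nat) : nat :=
  \max_(S : {set 'I_q} | solution_free c b S) #|S|.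

Definition max_rhs (l : nat) (b : 'I_l -> nat) : nat := \max_(i < l) b i.

Local Open Scope ring_scope.

Definition gamma1 (R : realType) (D : nat) : R :=
  D%:R ^+ 2 * Num.sqrt (2^-1 * ln D%:R).

Definition gamma2 (R : realType) (D : nat) : R :=
  2 * Num.sqrt (2 * ln D%:R).

(* Main.v *)
(* Behrend's construction.  Put D = max b, fix n and d, and take the integers
   whose n digits in base M = D d + 1 are at most d and form a vector on a fixed
   sphere about the origin.  When M ^ n <= q neither side of an equation carries
   or wraps around modulo q, so a solution is a convex combination, digit by
   digit, of points of the sphere and is therefore constant.  By pigeonhole some
   sphere contains at least (d + 1) ^ n / (n d ^ 2 + 1) points.  With d about
   q ^ (1 / n) / D, the exponent lost is n ln D + 2 (ln q) / n, which is least
   for n near t = sqrt (2 ln q / ln D). *)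

Require Import Defs.
From mathcomp Require Import all_boot all_order all_algebra.
From mathcomp Require Import all_classical all_reals all_analysis.
From mathcomp Require Import ring lra zify.

Import Order.TTheory GRing.Theory Num.Theory.
Import numFieldNormedType.Exports.

Local Open Scope nat_scope.

(** * Digit expansions and points on a sphere *)

Lemma sum_digits_lt (M n : nat) (f : 'I_n -> nat) :
  (forall i, f i < M) -> \sum_(i < n) f i * M ^ i < M ^ n.
Proof.
elim: n f => [|n IHn] f fM; first by rewrite big_ord0.
have := IHn (fun i => f (lift ord0 i)) (fun i => fM _).
rewrite big_ord_recl expn0 muln1 => ltS.
have -> : \sum_(i < n) f (lift ord0 i) * M ^ lift ord0 i
        = M * \sum_(i < n) f (lift ord0 i) * M ^ i.
  rewrite big_distrr; apply: eq_bigr => i _ /=.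
  by rewrite /bump add1n expnS; lia.
by have := fM ord0; rewrite expnS; nia.
Qed.

Lemma sum_digits_inj (M n : nat) (f g : 'I_n -> nat) :
  (forall i, f i < M) -> (forall i, g i < M) ->
  \sum_(i < n) f i * M ^ i = \sum_(i < n) g i * M ^ i -> f =1 g.
Proof.
elim: n f g => [|n IHn] f g fM gM; first by move=> _ [].
have shift (h : 'I_n.+1 -> nat) : \sum_(i < n.+1) h i * M ^ i
    = (\sum_(i < n) h (lift ord0 i) * M ^ i) * M + h ord0.
  rewrite big_ord_recl expn0 muln1 addnC big_distrl; congr (_ + _).
  by apply: eq_bigr => i _ /=; rewrite /bump add1n expnSr mulnA.
rewrite !shift => eqfg.
have M_gt0 : 0 < M by apply: leq_ltn_trans (fM ord0).
have eq0 : f ord0 = g ord0.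
  by have := congr1 (modn^~ M) eqfg; rewrite !modnMDl !modn_small.
have := congr1 (divn^~ M) eqfg; rewrite !divnMDl // !divn_small // !addn0.
move=> /(IHn _ _ (fun i => fM _) (fun i => gM _)) eqS i.
by case: (unliftP ord0 i) => [j ->|->]; [exact: eqS | exact: eq0].
Qed.

(* Strict convexity of the sphere: with all the points on it,
   [\sum_i \sum_j c j * (u j i - v i) ^ 2 = 0]. *)
Lemma sphere_mean_eq (m n k : nat) (c : 'I_m -> nat) (u : 'I_m -> 'I_n -> nat)
    (v : 'I_n -> nat) :
  (forall i, \sum_(j < m) c j * u j i = (\sum_(j < m) c j) * v i) ->
  (forall j, \sum_(i < n) u j i ^ 2 = k) -> \sum_(i < n) v i ^ 2 = k ->
  forall j, c j != 0 -> u j =1 v.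
Proof.
move=> mean u_k v_k j cj0 i.
(* The differences live in [int] because subtraction in [nat] truncates. *)
pose F (j : 'I_m) (i : 'I_n) : int :=
  (Posz (c j) * (Posz (u j i) - Posz (v i)) ^+ 2)%R.
have F0 : (\sum_j \sum_i F j i = 0)%R.
  have split_F (j' : 'I_m) : (\sum_i F j' i = Posz (c j') * (Posz k + Posz k) -
      2 * \sum_i Posz (c j') * Posz (u j' i) * Posz (v i))%R.
    rewrite mulrDr -{1}(u_k j') -v_k !(big_morph _ PoszD (erefl (Posz 0))).
    rewrite !mulr_sumr -big_split -sumrB; apply: eq_bigr => i' _ /=.
    by rewrite /F -!mulnn !PoszM; ring.
  rewrite (eq_bigr _ (fun j' _ => split_F j')) sumrB -mulr_suml.
  rewrite -mulr_sumr exchange_big /=.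
  (* Cross term: [mean] turns it into [\sum_j c j] times the squared norm of [v], so twice it
     cancels the [k + k] of the two squares. *)
  have -> : (\sum_(i < n) \sum_(j < m) Posz (c j) * Posz (u j i) * Posz (v i) =
             Posz (\sum_(j < m) c j) * Posz k)%R.
    rewrite -v_k !(big_morph _ PoszD (erefl (Posz 0))) mulr_sumr.
    apply: eq_bigr => i' _; rewrite -mulr_suml.
    have := congr1 Posz (mean i').
    rewrite !PoszM !(big_morph _ PoszD (erefl (Posz 0))) => ->.
    by rewrite mulrA.
  by rewrite (big_morph _ PoszD (erefl (Posz 0))); ring.
have F_ge0 j' i' : (0 <= F j' i')%R by rewrite mulr_ge0 ?sqr_ge0.
have /(_ j isT)/eqP := psumr_eq0P (fun j' _ => sumr_ge0 _ (fun i' _ => F_ge0 j' i')) F0.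
move/eqP/(psumr_eq0P (fun i' _ => F_ge0 j i'))/(_ i isT)/eqP.
rewrite mulf_eq0 sqrf_eq0 subr_eq0.
by case/orP => /eqP [] // /eqP; rewrite (negbTE cj0).
Qed.

Lemma pigeonhole_fiber (T : finType) (B : nat) (N : T -> nat) :
  (forall x, N x <= B) ->
  exists k, #|T| <= #|[set x | N x == k]%SET| * B.+1.
Proof.
move=> NB.
pose fiber (k : 'I_B.+1) := #|[set x | N x == k]%SET|.
have [k maxk] : {k | \max_k fiber k = fiber k}.
  by apply: bigop.eq_bigmax; rewrite card_ord.
exists (val k); rewrite -/(fiber k) -maxk.
have -> : #|T| = \sum_(k < B.+1) fiber k.
  rewrite -sum1_card (partition_big (fun x => inord (N x) : 'I_B.+1) xpredT) //=.
  apply: eq_bigr => k' _; rewrite /fiber -sum1_card; apply: eq_bigl => x.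
  by rewrite inE -val_eqE /= inordK // ltnS.
have -> : (\max_k fiber k) * B.+1 = \sum_(k' < B.+1) \max_k fiber k.
  by rewrite sum_nat_const card_ord mulnC.
by apply: leq_sum => k' _; exact: leq_bigmax.
Qed.

Lemma behrend_sphere (q l m n d : nat) (c : 'I_l -> 'I_m -> nat)
    (b : 'I_l -> nat) :
  (forall i, \sum_(j < m) c i j = b i) -> (forall i, 0 < b i) ->
  0 < max_rhs b -> (max_rhs b * d).+1 ^ n <= q ->
  d.+1 ^ n <= max_solution_free q c b * (n * d ^ 2).+1.
Proof.
set D := max_rhs b => c_sum b_gt0 D_gt0; set M := (D * d).+1 => Mq.
pose dig (x : {ffun 'I_n -> 'I_d.+1}) i : nat := x i.
pose num x := \sum_(i < n) dig x i * M ^ i.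
have le_d x i : dig x i <= d by rewrite -ltnS ltn_ord.
have leD i : b i <= D by exact: leq_bigmax.
have scale_lt e x i : e <= D -> e * dig x i < M.
  by move=> eD; rewrite ltnS leq_mul.
have num_lt x : num x < q.
  apply: leq_trans Mq; apply: sum_digits_lt => i.
  by rewrite -(mul1n (dig x i)) scale_lt.
pose ord x := Ordinal (num_lt x).
have ord_inj : injective ord.
  move=> x y /(congr1 val) /= /sum_digits_inj xy; apply/ffunP => i.
  by apply/val_inj/xy => i'; rewrite -(mul1n (dig _ i')) scale_lt.
have [|k] := @pigeonhole_fiber {ffun 'I_n -> 'I_d.+1} (n * d ^ 2)
    (fun x => \sum_i dig x i ^ 2).
  move=> x; have -> : n * d ^ 2 = \sum_(i < n) d ^ 2.
    by rewrite sum_nat_const card_ord.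
  by apply: leq_sum => i _; rewrite leq_exp2r.
rewrite card_ffun !card_ord => /leq_trans -> //; rewrite leq_mul2r /=.
rewrite -(card_imset _ ord_inj).
apply: (@leq_bigmax_cond _ _ (fun S : {set 'I_q} => #|S|)).
apply/forallP => i; apply/negP => /existsP[u /existsP[v /and5P[uS vS _ uv eq_uv]]].
have /fin_all_exists2[x xk ux] j : exists2 x, \sum_i dig x i ^ 2 = k & u j = ord x.
  by have /imsetP[x] := forallP uS j; rewrite inE => /eqP; exists x.
have /imsetP[y] := vS; rewrite inE => /eqP yk vy.
pose s i' := \sum_(j < m) c i j * dig (x j) i'.
(* The coefficients sum to [b i <= D] and digits are at most [d], so the [s i'] are genuine base-[M]
   digits of the left side. *)
have s_lt i' : s i' < M.
  apply: leq_ltn_trans (_ : D * d < M) => //.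
  rewrite (leq_trans _ (leq_mul (leD i) (leqnn d))) //.
  by rewrite -c_sum big_distrl leq_sum // => j _; rewrite leq_mul.
have sE : \sum_(j < m) c i j * u j = \sum_(i' < n) s i' * M ^ i'.
  under [RHS]eq_bigr do rewrite /s big_distrl.
  rewrite exchange_big; apply: eq_bigr => j _.
  by rewrite ux big_distrr; apply: eq_bigr => i' _; rewrite /= mulnA.
have vE : b i * v = \sum_(i' < n) (b i * dig y i') * M ^ i'.
  by rewrite vy big_distrr; apply: eq_bigr => i' _; rewrite /= mulnA.
(* Both sides are below [M ^ n <= q], so the congruence is an equality of integers. *)
move: eq_uv; rewrite sE vE !modn_small; last 2 first.
- by apply: leq_trans Mq; apply: sum_digits_lt => i'; exact: scale_lt.
- by apply: leq_trans Mq; apply: sum_digits_lt.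
move=> /eqP /sum_digits_inj eq_s.
have mean i' : s i' = (\sum_(j < m) c i j) * dig y i'.
  by rewrite c_sum; apply: eq_s => // ?; exact: scale_lt.
(* As [b i > 0], some [u j] has a nonzero coefficient; it must equal [v], against properness. *)
have [j cj0] : exists j, c i j != 0.
  apply/existsP; apply: contraTT (b_gt0 i); rewrite negb_exists => /forallP c0.
  by rewrite -c_sum big1 // => j _; apply/eqP; have := c0 j; rewrite negbK.
have xy := sphere_mean_eq _ _ _ _ _ _ mean xk yk j cj0.
have /eqP[] := forallP uv j; rewrite ux vy; congr ord; apply/ffunP => i'.
exact/val_inj/xy.
Qed.

(** * Real estimates and the choice of dimension *)

Local Open Scope classical_set_scope.
Local Open Scope ring_scope.

Lemma bernoulli_1B (R : realDomainType) (a : R) (k : nat) :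
  0 <= a <= 1 -> 1 - k%:R * a <= (1 - a) ^+ k.
Proof.
move=> /andP[a0 a1]; elim: k => [|k IHk]; first by rewrite mul0r subr0 expr0.
rewrite exprS; apply: le_trans (ler_wpM2l _ IHk); last by rewrite subr_ge0.
rewrite -natr1; have : 0 <= k%:R * a ^+ 2 by rewrite mulr_ge0 ?sqr_ge0.
by lra.
Qed.

(** The dimension is [n = k + 2], and [d] is the integer part of [z = (y - 1) / D], so
    [D d + 1 <= y]. As [z >= 1], [n d ^ 2 + 1 <= (n + 1) z ^ 2]; cancelling [z ^ 2] leaves the
    exponent [k]. *)
Lemma behrend_real (R : realType) (q l m k : nat) (c : 'I_l -> 'I_m -> nat)
    (b : 'I_l -> nat) (y : R) :
  (forall i, (\sum_(j < m) c i j)%N = b i) -> (forall i, 0 < b i)%N ->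
  (0 < max_rhs b)%N -> 1 + (max_rhs b)%:R <= y -> y ^+ k.+2 <= q%:R ->
  ((y - 1) / (max_rhs b)%:R) ^+ k
    <= (max_solution_free q c b)%:R * k.+3%:R.
Proof.
move=> c_sum b_gt0; set D := max_rhs b => D_gt0 yD yq.
have D0 : 0 < D%:R :> R by rewrite ltr0n.
set z := (y - 1) / D%:R.
have z1 : 1 <= z by rewrite ler_pdivlMr // mul1r; lra.
have /andP[dz zd] := truncn_itv (le_trans ler01 z1).
set d := Num.truncn z in dz zd.
have Mq : ((D * d).+1 ^ k.+2 <= q)%N.
  rewrite -(ler_nat R) natrX; apply: le_trans yq.
  have : (D * d).+1%:R <= y by rewrite -natr1 natrM -lerBrDr mulrC -ler_pdivlMr.
  by apply: lerXn2r; rewrite nnegrE //; lra.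
have := behrend_sphere _ _ _ _ _ _ _ c_sum b_gt0 D_gt0 Mq.
rewrite -(ler_nat R) natrX natrM => count.
have z2 : 0 < z ^+ 2 by rewrite exprn_gt0 // (lt_le_trans ltr01).
rewrite -(ler_pM2r z2) -exprD addn2 -mulrA.
apply: (@le_trans _ _ (d.+1%:R ^+ k.+2)).
  by rewrite lerXn2r ?nnegrE ?(ltW zd) //; lra.
apply: le_trans count _; rewrite ler_wpM2l // -natr1 natrM natrX.
have : d%:R ^+ 2 <= z ^+ 2 by rewrite lerXn2r ?nnegrE //; lra.
have : 1 <= z ^+ 2 by rewrite expr_ge1 //; lra.
have : k.+3%:R = k.+2%:R + 1 :> R by rewrite natr1.
have : 0 <= k.+2%:R :> R by [].
by nra.
Qed.

Lemma expR_ge_sqr (R : realType) (x : R) : 0 <= x -> (x / 2) ^+ 2 <= expR x.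
Proof.
move=> x0; have -> : expR x = expR (x / 2) ^+ 2.
  by rewrite -expRM_natl; congr expR; lra.
by rewrite lerXn2r ?nnegrE ?expR_ge0 //; have := expR_ge1Dx (x / 2); lra.
Qed.

(** As [n <= 2 t], the exponent is at least [lam t / 4]. Hence for large [t] the digit base outgrows
    both [D] and the dimension. *)
Lemma expR_mul_sqr_div_ge (R : realType) (lam t n : R) :
  0 <= lam -> 1 <= t -> 0 < n <= t + 1 ->
  (lam * t / 8) ^+ 2 <= expR (lam * t ^+ 2 / 2 / n).
Proof.
move=> lam0 t1 /andP[n0 nt].
have lt0 : 0 <= lam * t by rewrite mulr_ge0 //; lra.
have -> : lam * t / 8 = lam * t / 4 / 2 by lra.
apply: le_trans (expR_ge_sqr _ _ _) _; first by rewrite divr_ge0.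
by rewrite ler_expR ler_pdivlMr //; nra.
Qed.

(* [2 lam t] is the minimum over [n > 0] of [n lam + 2 L / n], where
   [L = lam t ^ 2 / 2], attained at [n = t]; rounding [t] up to the integer
   [n = k + 2] costs [lam (n - t) ^ 2 / n <= lam / t]. *)
Lemma rounded_exponent_bound (R : realType) (lam t s : R) (k : nat) :
  0 < lam -> 128 / lam ^+ 2 + lam + 2 <= t -> t < k.+2%:R <= t + 1 ->
  ((expR (lam * t ^+ 2 / 2 / k.+2%:R) - 1) / expR lam) ^+ k <= s * k.+3%:R ->
  expR (2 * lam + lam * t ^+ 2 / 2 - 2 * lam * t) / t
    * (1 - (128 / lam ^+ 2 + lam + 2) / t) <= s.
Proof.
move=> lam0; set C := 128 / lam ^+ 2 => Ct /andP[tn nt].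
set n := k.+2%:R in tn nt *; set y := expR (_ / n).
have C0 : 0 < C by rewrite divr_gt0 // exprn_gt0.
have t2 : 2 < t by lra.
have n0 : 0 < n by lra.
have y_ge : (lam * t / 8) ^+ 2 <= y.
  by apply: expR_mul_sqr_div_ge; rewrite ?n0 //; lra.
(* Since [k <= 2 t], the bound is [2 t / (lam t / 8) ^ 2 = 128 / (lam ^ 2 t)], whence the constant
   128. *)
have ky : k%:R * y^-1 <= C / t.
  have sq0 : 0 < (lam * t / 8) ^+ 2 by rewrite exprn_gt0 // divr_gt0 // mulr_gt0; lra.
  apply: (@le_trans _ _ (2 * t / (lam * t / 8) ^+ 2)).
    apply: ler_pM => //; rewrite ?invr_ge0 ?expR_ge0 //.
      have nk : n = k%:R + 2 by rewrite -natrD addn2.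
      by lra.
    by rewrite lef_pV2 ?posrE ?expR_gt0.
  rewrite le_eqVlt; apply/orP; left; apply/eqP; rewrite /C; field.
  by apply/andP; split; lra.
have y0 : 0 < y by exact: expR_gt0.
have y1 : 1 <= y.
  by rewrite -expR0 ler_expR !divr_ge0 ?mulr_ge0 ?sqr_ge0 //; lra.
(* Splits off the loss from subtracting 1, which Bernoulli's inequality controls, from the main
   exponential. *)
have -> : (y - 1) / expR lam = (1 - y^-1) * expR (lam * t ^+ 2 / 2 / n - lam).
  by rewrite expRB -/y; field; rewrite !gt_eqF ?expR_gt0.
rewrite exprMn -expRM_natl => count.
set E := expR _.
have E0 : 0 < E by exact: expR_gt0.
have expo : E * (1 - lam / t) <= expR (k%:R * (lam * t ^+ 2 / 2 / n - lam)).
  apply: (@le_trans _ _ (E * expR (- (lam / t)))).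
    by rewrite ler_pM2l //; exact: expR_ge1Dx.
  rewrite -expRD ler_expR.
  have -> : k%:R = n - 2 by rewrite /n -addn2 natrD addrK.
  rewrite -subr_ge0.
  have -> : (n - 2) * (lam * t ^+ 2 / 2 / n - lam) -
      (2 * lam + lam * t ^+ 2 / 2 - 2 * lam * t - lam / t) =
      lam * (t^-1 - (n - t) ^+ 2 / n).
    by field; apply/andP; split; lra.
  apply: mulr_ge0; first exact: ltW.
  rewrite subr_ge0 ler_pdivrMr // ler_pdivlMl; last lra.
  have : (n - t) ^+ 2 <= 1 by rewrite expr_le1 //; lra.
  by nra.
have bern : 1 - C / t <= (1 - y^-1) ^+ k.
  apply: le_trans (bernoulli_1B _ _ _ _); first by rewrite lerD2l lerN2.
  by rewrite invr_ge0 ltW //= invf_le1.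
have Ct1 : C / t <= 1 by rewrite ler_pdivrMr; lra.
have lt1 : lam / t <= 1 by rewrite ler_pdivrMr; lra.
have prod : (1 - C / t) * (E * (1 - lam / t)) <= s * k.+3%:R.
  apply: le_trans count; apply: ler_pM => //; first by lra.
  by rewrite pmulr_rge0 // subr_ge0.
have k3 : k.+3%:R = n + 1 by rewrite natr1.
(* As [n + 1 <= t + 2], replacing [n + 1] by [t] costs a factor [1 + 2 / t]; the summand 2 of the
   constant pays for it. *)
have : E / t * (1 - (C + lam + 2) / t) * (n + 1) <= s * (n + 1).
  rewrite -k3; apply: le_trans prod; rewrite k3.
  have -> : E / t * (1 - (C + lam + 2) / t) * (n + 1) =
      E * (t^-1 * ((1 - (C + lam + 2) / t) * (n + 1))) by ring.
  rewrite [leRHS]mulrCA ler_pM2l //.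
  have slack : (C + lam + 2) / t <= 1 by rewrite ler_pdivrMr; lra.
  have u0 : 0 < C / t by rewrite divr_gt0; lra.
  have v0 : 0 < lam / t by rewrite divr_gt0; lra.
  have w0 : 0 < t^-1 by rewrite invr_gt0; lra.
  have wt : t^-1 * (n + 1) <= 1 + 2 * t^-1.
    by rewrite mulrC ler_pdivrMr ?mulrDl ?mulfVK; lra.
  have splitC : (C + lam + 2) / t = C / t + lam / t + 2 * t^-1 by rewrite !mulrDl.
  rewrite mulrCA splitC in slack *.
  set u := C / t in Ct1 slack u0 *; set v := lam / t in lt1 slack v0 *.
  set w := t^-1 in slack w0 wt *.
  apply: (@le_trans _ _ ((1 - (u + v + 2 * w)) * (1 + 2 * w))).
    by rewrite ler_wpM2l ?subr_ge0.
  have : 0 < u * v by rewrite mulr_gt0.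
  have : 0 < u * w by rewrite mulr_gt0.
  have : 0 < v * w by rewrite mulr_gt0.
  have : 0 < w * w by rewrite mulr_gt0.
  by nra.
by rewrite ler_pM2r; lra.
Qed.

(** * The error term and the final bound *)

Lemma cvg_div_sqrt_ln (R : realType) (K : R) :
  (fun q : nat => K / Num.sqrt (ln q%:R)) @ \oo --> (0 : R).
Proof.
apply/cvgr0Pnorm_le => e e0; near=> q.
(* The added 1 keeps [ln q] positive even when [K = 0]. *)
have q_ge : expR ((`|K| / e) ^+ 2 + 1) <= q%:R.
  by near: q; exact: nbhs_infty_ger.
have q0 : 0 < q%:R :> R by apply: lt_le_trans q_ge; exact: expR_gt0.
have ln_q : (`|K| / e) ^+ 2 + 1 <= ln q%:R.
  by rewrite -ler_expR lnK.
have ln0 : 0 < ln q%:R :> R.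
  by apply: lt_le_trans ln_q; rewrite ltr_wpDl ?sqr_ge0.
rewrite normf_div [`|Num.sqrt _|]ger0_norm ?sqrtr_ge0 //.
rewrite ler_pdivrMr ?sqrtr_gt0 // mulrC -ler_pdivrMr //.
rewrite -[leLHS]ger0_norm ?divr_ge0 ?(ltW e0) // -sqrtr_sqr ler_sqrt ?(ltW ln0) //.
by apply: le_trans ln_q; rewrite lerDl.
Unshelve. all: by end_near.
Qed.

Theorem theorem8 (R : realType) (l m : nat)
    (c : 'I_l -> 'I_m -> nat) (b : 'I_l -> nat)
    (l_gt0 : (0 < l)%N)
    (c_two_nonzero : forall i : 'I_l, (2 <= #|[set j : 'I_m | c i j != 0%N]%SET|)%N)
    (c_sum : forall i : 'I_l, (\sum_(j < m) c i j)%N = b i)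
    (b_gt0 : forall i : 'I_l, (0 < b i)%N) :
  let D := max_rhs b in
  exists eps : nat -> R,
    eps @ \oo --> (0 : R) /\
    forall q : nat, (D ^ 2 < q)%N ->
      gamma1 R D * q%:R *
        expR (- gamma2 R D * Num.sqrt (ln q%:R) - 2^-1 * ln (ln q%:R)) *
        (1 + eps q)
      <= (max_solution_free q c b)%:R.
Proof.
move=> D.
(* For [D <= 1] the left side is zero, through [D ^ 2 = 0] or [ln 1 = 0]. *)
have [D1|D1] := leqP D 1.
  exists (fun=> 0); split=> [|q _]; first exact: cvg_cst.
  suff -> : gamma1 R D = 0 by rewrite !mul0r.
  rewrite /gamma1; case: (D) D1 => [|[|//]] _; first by rewrite expr0n mul0r.
  by rewrite ln1 mulr0 sqrtr0 mulr0.
have D0 : 0 < D%:R :> R by rewrite ltr0n ltnW.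
set lam : R := ln D%:R.
have expD : expR lam = D%:R by rewrite lnK.
have lam0 : 0 < lam by rewrite ln_gt0 // ltr1n.
(* [gamma2] is [2 h] and the root in [gamma1] is [h / 2]. *)
set h := Num.sqrt (2 * lam).
have h0 : 0 < h by rewrite sqrtr_gt0 mulr_gt0.
have h2 : h ^+ 2 = 2 * lam by rewrite sqr_sqrtr // mulr_ge0 // ltW.
pose C := 128 / lam ^+ 2 + lam + 2.
(* For [t < K] the factor [1 - K / t] is negative and the bound is void, so a
   single [eps] serves all [q]. *)
pose K := C + 8 * (D%:R + 1) / lam.
(* This is [- K / t] for [t = 2 sqrt (ln q) / h], the optimal real dimension. *)
exists (fun q : nat => - (K * h / 2) / Num.sqrt (ln q%:R)); split.
  exact: cvg_div_sqrt_ln.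
move=> q Dq.
have q1 : 1 < q%:R :> R by rewrite ltr1n (leq_ltn_trans _ Dq) // expn_gt0 ltnW.
have ln0 : 0 < ln q%:R :> R by rewrite ln_gt0.
set r := Num.sqrt (ln q%:R).
have r0 : 0 < r by rewrite sqrtr_gt0.
have r2 : r ^+ 2 = ln q%:R by rewrite sqr_sqrtr // ltW.
pose t := 2 * r / h.
have t0 : 0 < t by rewrite divr_gt0 // mulr_gt0.
have lamE : lam = h ^+ 2 / 2 by rewrite h2; lra.
have lntE : ln q%:R = lam * t ^+ 2 / 2.
  by rewrite lamE -r2 /t; field; rewrite gt_eqF.
have expq : expR (lam * t ^+ 2 / 2) = q%:R by rewrite -lntE lnK // posrE; lra.
(* Here [D ^ 2 * q] gives the positive exponents, [gamma2 * r = 2 lam t], and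
   [(h / 2) / r = 1 / t]. *)
have -> : gamma1 R D * q%:R *
    expR (- gamma2 R D * r - 2^-1 * ln (ln q%:R)) =
    expR (2 * lam + lam * t ^+ 2 / 2 - 2 * lam * t) / t.
  have -> : expR (- gamma2 R D * r - 2^-1 * ln (ln q%:R)) = expR (- (2 * lam * t)) / r.
    have -> : 2^-1 * ln (ln q%:R) = ln r by rewrite -r2 lnXn //; lra.
    rewrite expRB lnK //; congr (expR _ / _).
    by rewrite /gamma2 -/lam -/h lamE /t; field; rewrite gt_eqF.
  rewrite !expRD expRM_natl expD expq /gamma1 -/lam.
  have -> : 2^-1 * lam = (h / 2) ^+ 2 by rewrite expr_div_n h2; field.
  rewrite sqrtr_sqr ger0_norm ?divr_ge0 ?ltW // /t.
  by field; rewrite !gt_eqF.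
have -> : 1 + - (K * h / 2) / r = 1 - K / t.
  by rewrite /t; field; rewrite !gt_eqF.
have main0 := expR_gt0 (2 * lam + lam * t ^+ 2 / 2 - 2 * lam * t).
have [tK|Kt] := ltP t K.
  apply: le_trans (ler0n _ _); apply: mulr_ge0_le0.
    by rewrite divr_ge0 // ltW.
  by rewrite subr_le0 ler_pdivlMr // mul1r ltW.
have K1 : 0 < 8 * (D%:R + 1) / lam by rewrite divr_gt0 // mulr_gt0 // addr_gt0.
have C0 : 0 < 128 / lam ^+ 2 by rewrite divr_gt0 // exprn_gt0.
apply: (@le_trans _ _
    (expR (2 * lam + lam * t ^+ 2 / 2 - 2 * lam * t) / t * (1 - C / t))).
  apply: ler_wpM2l; first by rewrite divr_ge0 // ltW.
  rewrite lerD2l lerN2 ler_pM2r ?invr_gt0 //.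
  by rewrite /K; lra.
have t2 : 2 <= t by move: Kt; rewrite /K /C; lra.
have /andP[kt tk] := truncn_itv (ltW t0).
have k1 : (0 < Num.truncn t)%N by rewrite truncn_gt_nat; lra.
(* Makes [k + 2] the least integer strictly above [t]. *)
pose k := (Num.truncn t).-1.
have kE : k.+2%:R = (Num.truncn t)%:R + 1 :> R by rewrite /k prednK // natr1.
apply: (@rounded_exponent_bound _ lam t _ k) => //.
- by move: Kt; rewrite /K /C; lra.
- by rewrite kE lerD2r kt andbT natr1.
rewrite expD; apply: behrend_real => //; rewrite -/D.
- exact: ltnW.
(* The second summand of [K] serves here: [lam t / 8 >= D + 1] gives a base of at least
   [(D + 1) ^ 2 >= 1 + D]. *)
- have lamt : 8 * (D%:R + 1) <= lam * t.
    by rewrite [leRHS]mulrC -ler_pdivrMr //; move: Kt; rewrite /K /C; lra.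
  apply: le_trans _ (expR_mul_sqr_div_ge _ lam t _ _ _ _).
  - apply: (@le_trans _ _ ((D%:R + 1) ^+ 2)); first by nra.
    by rewrite lerXn2r ?nnegrE //; lra.
  - exact: ltW.
  - by lra.
  - by rewrite kE; lra.
(* The base is exactly [q ^ (1 / (k + 2))]. *)
- by rewrite -expRM_natl -expq ler_expR mulrC mulfVK.
Qed.
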